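(* Let $\Gamma$ be a finitely generated residually finite discrete group and let $\square\Gamma$ be its box space with respect to a nested family $\{N_i\}_{i\in\mathbb N}$ of finite index normal subgroups with trivial intersection. If the box space $\square\Gamma$ admits a fibred coarse embedding into Hilbert space, then the group $\Gamma$ is a-T-menable.
   Context: **Box space.** Fix a finite generating set $S$ of $\Gamma$. The box space $\square\Gamma$ of $\Gamma$ with respect to the family $\{N_i\}_{i\in\mathbb N}$ is the coarse disjoint union of the sequence of finite Cayley graphs $X_i=\mathrm{Cay}(\Gamma/N_i,S)$. Here, the coarse disjoint union of a sequence of finite metric spaces $\{X_i\}$, uniformly discrete with bounded geometry uniformly in $i$ and with $|X_i|\to\infty$, is the set $\sqcup_iX_i$ with a metric $d$ that restricts to the given metric on each $X_i$ and satisfies $d(X_i,X_j)\to\infty$ as $i+j\to\infty$ (for $i\ne j$); it is unique up to coarse equivalence. **Fibred coarse embedding.** A metric space $X$ admits a fibred coarse embedding into Hilbert space if there exist: a field of Hilbert spaces $\{H_x\}_{x\in X}$ over $X$; a section $s:X\to\sqcup_{x\in X}H_x$ (i.e. $s(x)\in H_x$); two non-decreasing functions $\rho_1,\rho_2:[0,\infty)\to(-\infty,+\infty)$ with $\lim_{r\to\infty}\rho_i(r)=\infty$ for $i=1,2$; and a reference Hilbert space $H$; such that for any $r>0$ there exist a bounded subset $K_r\subset X$ and, for each $C\subset X\setminus K_r$ of diameter less than $r$, a trivialisation $t_C:\sqcup_{x\in C}H_x\to C\times H$ whose restriction $t_C(x)$ to each $H_x$ is an affine isometry from $H_x$ to $H$,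 satisfying: (1) for any $x,y\in C$, $\rho_1(d(x,y))\le\|t_C(x)(s(x))-t_C(y)(s(y))\|\le\rho_2(d(x,y))$; (2) for any two subsets $C_1,C_2\subset X\setminus K_r$ of diameter less than $r$ with $C_1\cap C_2\neq\emptyset$ there exists an affine isometry $t_{C_1,C_2}:H\to H$ such that $t_{C_1}(x)t_{C_2}(x)^{-1}=t_{C_1,C_2}$ for all $x\in C_1\cap C_2$. **A-T-menable group.** A discrete group is a-T-menable (has the Haagerup property) if it admits a proper conditionally negative type function, equivalently a metrically proper affine isometric action on a Hilbert space. *)

(* Defs.v *)
From HB Require Import structures.
From mathcomp Require Import all_boot all_order all_algebra.
From mathcomp Require Import all_classical all_reals.
From mathcomp Require Import ereal topology normedtype.

Set Implicit Arguments.
Unset Strict Implicit.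
Unset Printing Implicit Defensive.

Import Order.TTheory GRing.Theory Num.Theory.
Import numFieldNormedType.Exports.

Local Open Scope classical_set_scope.
Local Open Scope quotient_scope.
Local Open Scope ring_scope.

(** * Groups, quotients and Cayley graphs *)

Definition is_subgroup (G : groupType) (A : set G) : Prop :=
  A 1%g /\ forall x y, A x -> A y -> A (x / y)%g.

Definition generates (G : groupType) (S : set G) : Prop :=
  smallest (@is_subgroup G) S = setT.

Record normalSubgroup (G : groupType) := NormalSubgroup {
  nsg_set :> set G;
  nsg_subgroup : is_subgroup nsg_set;
  nsg_conj : forall x g, nsg_set x -> nsg_set (x ^ g)%g
}.

Section Quotient.
Variables (G : groupType) (N : normalSubgroup G).
Implicit Types x y z : G.

Lemma nsg1 : nsg_set N 1%g. Proof. by case: (nsg_subgroup N). Qed.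

Lemma nsgV x : nsg_set N x -> nsg_set N x^-1%g.
Proof.
by case: (nsg_subgroup N) => N1 ND Nx; have := ND _ _ N1 Nx; rewrite mul1g.
Qed.

Lemma nsgM x y : nsg_set N x -> nsg_set N y -> nsg_set N (x * y)%g.
Proof.
case: (nsg_subgroup N) => _ ND Nx Ny.
by have := ND _ _ Nx (nsgV Ny); rewrite invgK.
Qed.

(* x and y lie in the same (left) coset of N *)
Definition coset_rel : rel G := fun x y => `[< nsg_set N (x^-1 * y)%g >].

Lemma coset_rel_refl : reflexive coset_rel.
Proof. by move=> x; apply/asboolP; rewrite mulVg; exact: nsg1. Qed.

Lemma coset_rel_sym : symmetric coset_rel.
Proof.
by move=> x y; apply/asboolP/asboolP => /nsgV; rewrite invgM invgK.
Qed.

Lemma coset_rel_trans : transitive coset_rel.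
Proof.
move=> y x z /asboolP Nxy /asboolP Nyz; apply/asboolP.
by have := nsgM Nxy Nyz; rewrite -mulgA mulVKg.
Qed.

Canonical coset_equiv :=
  EquivRel coset_rel coset_rel_refl coset_rel_sym coset_rel_trans.

Definition quotg := {eq_quot coset_equiv}.

HB.instance Definition _ := Choice.on quotg.
HB.instance Definition _ := EqQuotient.on quotg.

(* the projection G -> G/N *)
Definition quotg_pi (x : G) : quotg := \pi_quotg x.

Lemma quotg_piE x y : quotg_pi x = quotg_pi y <-> nsg_set N (x^-1 * y)%g.
Proof.
rewrite /quotg_pi; split=> [/eqmodP/asboolP //|Nxy].
by apply/eqmodP/asboolP.
Qed.

Lemma quotg_piK (a : quotg) : quotg_pi (repr a) = a.
Proof. exact: reprK. Qed.

Definition quotg_one : quotg := quotg_pi 1%g.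
Definition quotg_inv (a : quotg) : quotg := quotg_pi (repr a)^-1%g.
Definition quotg_mul (a b : quotg) : quotg := quotg_pi (repr a * repr b)%g.

Lemma quotg_invE x : quotg_inv (quotg_pi x) = quotg_pi x^-1%g.
Proof.
apply/quotg_piE; rewrite invgK.
have /quotg_piE/nsgV := quotg_piK (quotg_pi x).
rewrite invgM invgK => /(nsg_conj x^-1%g).
by rewrite /conjg invgK !mulgA mulgV mul1g.
Qed.

Lemma quotg_mulE x y :
  quotg_mul (quotg_pi x) (quotg_pi y) = quotg_pi (x * y)%g.
Proof.
apply/quotg_piE.
have /quotg_piE Nx := quotg_piK (quotg_pi x).
have /quotg_piE Ny := quotg_piK (quotg_pi y).
have := nsgM (nsg_conj (repr (quotg_pi y)) Nx) Ny.
by rewrite /conjg invgM -!mulgA mulVKg.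
Qed.

Lemma quotg_mulA : associative quotg_mul.
Proof.
move=> a b c; rewrite -[a]quotg_piK -[b]quotg_piK -[c]quotg_piK.
by rewrite !quotg_mulE mulgA.
Qed.

Lemma quotg_mul1g : left_id quotg_one quotg_mul.
Proof. by move=> a; rewrite -[a]quotg_piK quotg_mulE mul1g. Qed.

Lemma quotg_mulg1 : right_id quotg_one quotg_mul.
Proof. by move=> a; rewrite -[a]quotg_piK quotg_mulE mulg1. Qed.

Lemma quotg_mulVg : left_inverse quotg_one quotg_inv quotg_mul.
Proof. by move=> a; rewrite -[a]quotg_piK quotg_invE quotg_mulE mulVg. Qed.

Lemma quotg_mulgV : right_inverse quotg_one quotg_inv quotg_mul.
Proof. by move=> a; rewrite -[a]quotg_piK quotg_invE quotg_mulE mulgV. Qed.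

HB.instance Definition _ := isGroup.Build quotg quotg_mulA quotg_mul1g
  quotg_mulg1 quotg_mulVg quotg_mulgV.

Lemma quotg_piM x y : quotg_pi (x * y)%g = (quotg_pi x * quotg_pi y)%g.
Proof. by rewrite -quotg_mulE. Qed.

Definition finite_index : Prop := finite_set [set: quotg].

End Quotient.

Definition residually_finite (G : groupType) : Prop :=
  forall g : G, g <> 1%g ->
    exists N : normalSubgroup G, finite_index N /\ ~ nsg_set N g.

Definition cayley_adj (Q : groupType) (S : set Q) : rel Q :=
  fun x y => `[< exists2 s, S s & y = (x * s)%g \/ x = (y * s)%g >].

(* The path metric of Cay(Q, S), for S generating Q: the infimum is then over a
   nonempty set of natural numbers, hence a minimum. *)
Definition cayley_dist (R : realType) (Q : groupType) (S : set Q) (x y : Q) : R :=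
  inf [set (size p)%:R | p in
        [set p : seq Q | path (cayley_adj S) x p /\ last x p = y]].

(** * Coarse disjoint unions and box spaces *)

(* The isometric inclusions X_ i -> X are bundled as one bijection iota from the
   disjoint union. That the cardinality of X_ i tends to infinity is not
   required, so that box spaces of finite groups are covered too; for the
   quotients below it is automatic when the group is infinite. Uniform
   discreteness and uniformly bounded geometry are automatic for Cayley graphs
   with respect to the images of one finite set. *)
Definition coarse_disjoint_union (R : realType) (X_ : nat -> Type)
    (dX : forall i, X_ i -> X_ i -> R)
    (X : metricType R) (iota : {i & X_ i} -> X) : Prop :=
  [/\ bijective iota,
      forall i x y, mdist (iota (existT _ i x)) (iota (existT _ i y)) = dX i x y
    & forall M : R, exists n : nat, forall i j, i <> j -> (n <= i + j)%N ->
        forall x y, M <= mdist (iota (existT _ i x)) (iota (existT _ j y))].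

Definition box_space (R : realType) (G : groupType) (S : set G)
    (N : nat -> normalSubgroup G) (X : metricType R) : Prop :=
  exists iota : {i & quotg (N i)} -> X,
    coarse_disjoint_union
      (fun i => @cayley_dist R (quotg (N i)) (quotg_pi (N i) @` S)) iota.

(** * Fibred coarse embeddings into Hilbert space *)

(* Hilbert spaces are real: an affine isometry between complex Hilbert spaces is
   in particular one between the underlying real spaces. *)
Record hilbertType (R : realType) := HilbertType {
  hilbert_sort :> completeNormedModType R;
  hdot : {dot hilbert_sort for idfun};
  hdot_norm : forall u : hilbert_sort, hdot u u = `|u| ^+ 2
}.

(* Affine isometries are onto, as the trivialisations are to be inverted. *)
Definition affine_isometry (R : realType) (U V : hilbertType R) (f : U -> V) :
    Prop :=
  [/\ exists (L : {linear U -> V}) (b : V), forall u, f u = L u + b,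
      forall u v, `|f u - f v| = `|u - v|
    & bijective f].

Definition control_function (R : realType) (rho : R -> R) : Prop :=
  {in `[0, +oo[ &, {homo rho : x y / x <= y}} /\ rho x @[x --> +oo] --> +oo.

(* -oo on the empty set *)
Definition diameter (R : realType) (X : metricType R) (C : set X) : \bar R :=
  ereal_sup [set (mdist x y)%:E | x in C & y in C].

(* Only the values t C x with x in C, and C of diameter less than r outside K,
   are constrained. Composing with the inverse of the bijection t C2 x turns the
   last clause into t_{C1}(x) t_{C2}(x)^{-1} = t_{C1,C2}. *)
Definition fibred_coarse_embedding (R : realType) (X : metricType R) : Prop :=
  exists (Hx : X -> hilbertType R) (s : forall x, Hx x) (rho1 rho2 : R -> R)
         (H : hilbertType R),
  [/\ control_function rho1, control_function rho2 &
    forall r : R, 0 < r ->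
    exists (K : set X) (t : set X -> forall x, Hx x -> H),
    let small (C : set X) := C `<=` ~` K /\ (diameter C < r%:E)%E in
    [/\ (diameter K < +oo)%E,
        forall C, small C -> forall x, C x -> affine_isometry (t C x),
        forall C, small C -> forall x y, C x -> C y ->
          rho1 (mdist x y) <= `|t C x (s x) - t C y (s y)| <= rho2 (mdist x y)
      & forall C1 C2, small C1 -> small C2 -> C1 `&` C2 !=set0 ->
          exists2 t12 : H -> H, affine_isometry t12 &
            forall x, (C1 `&` C2) x -> t C1 x = t12 \o t C2 x]].

(** * A-T-menability *)

Definition conditionally_negative (R : realType) (G : groupType)
    (psi : G -> R) : Prop :=
  [/\ psi 1%g = 0,
      forall g, psi g^-1%g = psi g
    & forall n (g : 'I_n -> G) (c : 'I_n -> R), \sum_i c i = 0 ->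
        \sum_i \sum_j c i * c j * psi ((g i)^-1 * g j)%g <= 0].

Definition proper_function (R : realType) (G : groupType) (psi : G -> R) : Prop :=
  forall M : R, finite_set [set g | `|psi g| <= M].

Definition a_T_menable (R : realType) (G : groupType) : Prop :=
  exists psi : G -> R, conditionally_negative psi /\ proper_function psi.

(* Main.v *)
Require Import Defs.
From mathcomp Require Import all_boot all_order all_algebra.
From mathcomp Require Import all_classical all_reals.
From mathcomp Require Import ereal topology normedtype.
From mathcomp Require Import lra.

(** Inside each finite quotient Q = G/N_i far enough out in the box space, let
psi_m(g) be the average over x in Q of the squared distance between the sections
at x and xg, read in any trivialisation around both points. Right translations
preserve the average, so psi_m satisfies the inequalities of conditional
negativity for all finite families of G whose mutual distances are at most m. A
pointwise limit along an ultrafilter is conditionally negative; it is finite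
thanks to rho2, and proper thanks to rho1, because an element outside a ball of G
stays outside the image of that ball in Q for all large i. *)

Set Implicit Arguments.
Unset Strict Implicit.
Unset Printing Implicit Defensive.

Import Order.TTheory GRing.Theory Num.Theory.
Import numFieldNormedType.Exports.

Local Open Scope classical_set_scope.
Local Open Scope ring_scope.

(** * Word balls of a group with respect to a subset *)

Section WordBall.
Variables (G : groupType) (S : set G).

Fixpoint word_ball (n : nat) : set G :=
  if n is m.+1 then
    word_ball m `|` [set (x * y)%g | x in word_ball m & y in S `|` [set s^-1%g | s in S]]
  else [set 1%g].

Lemma word_ball_finite n : finite_set S -> finite_set (word_ball n).
Proof.
move=> finS; elim: n => [|n IH] /=; first exact: finite_set1.
rewrite finite_setU; split=> //; apply: finite_image2 => //.
by rewrite finite_setU; split=> //; exact: finite_image.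
Qed.

Lemma word_ball_homo : {homo word_ball : m n / (m <= n)%N >-> m `<=` n}.
Proof.
apply: homo_leq; [by move=> ?|by move=> B A C; exact: subset_trans|].
by move=> n; exact: subsetUl.
Qed.

Lemma word_ballM m n x y :
  word_ball m x -> word_ball n y -> word_ball (m + n) (x * y)%g.
Proof.
move=> mx; elim: n y => [|n IH] y /=; first by move=> ->; rewrite mulg1 addn0.
rewrite addnS => -[ny|[u nu [s Ss <-]]]; first by left; exact: IH.
by right; exists (x * u)%g; [exact: IH|exists s => //; rewrite mulgA].
Qed.

Lemma word_ball1 s : S s -> word_ball 1 s /\ word_ball 1 s^-1%g.
Proof.
by move=> Ss; split; right; exists 1%g => //;
  [exists s; [left|rewrite mul1g]|exists s^-1%g; [right; exists s|rewrite mul1g]].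
Qed.

Lemma word_ballV n x : word_ball n x -> word_ball n x^-1%g.
Proof.
elim: n x => [|n IH] x /=; first by move=> ->; rewrite invg1.
case=> [nx|[u nu [s Ss <-]]]; first by left; exact: IH.
rewrite invgM; apply: (@word_ballM 1 n); last exact: IH.
by case: Ss => [/word_ball1[]//|[t /word_ball1[St _] <-]]; rewrite invgK.
Qed.

(** The union of the balls is a subgroup containing [S], so minimality applies. *)
Lemma word_ball_exhaust : generates S -> forall g, exists n, word_ball n g.
Proof.
move=> genS g.
suff : smallest (@is_subgroup G) S `<=` [set g | exists n, word_ball n g].
  by apply; rewrite [smallest _ _]genS.
apply: smallest_sub => [|s Ss]; last by exists 1%N; case: (word_ball1 Ss).
split=> [|x y [m mx] [n ny]]; first by exists 0%N.
by exists (m + n)%N; apply: word_ballM => //; exact: word_ballV.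
Qed.

End WordBall.

(** * Path metric of a quotient against word length in the group *)

Section CayleyQuotient.
Variables (R : realType) (G : groupType) (S : set G) (N : normalSubgroup G).
Let p := @quotg_pi G N.
Let dist : quotg N -> quotg N -> R := cayley_dist R (p @` S).

Lemma quotg_pi1 : p 1%g = 1%g. Proof. by []. Qed.

Lemma quotg_piV x : p x^-1%g = (p x)^-1%g.
Proof. by rewrite /p -quotg_invE. Qed.

(** Each edge lifts to a generator or its inverse; [w] is the product of these letters. *)
Lemma cayley_path_word x s : path (cayley_adj (p @` S)) x s ->
  exists2 w, word_ball S (size s) w & last x s = (x * p w)%g.
Proof.
elim: s x => [|y s IH] x /=; first by exists 1%g; rewrite ?quotg_pi1 ?mulg1.
case/andP=> /asboolP[_ [t St <-] xy] /IH[w sw ->].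
suff [u u1 ->] : exists2 u, word_ball S 1 u & y = (x * p u)%g.
  exists (u * w)%g; last by rewrite /p quotg_piM mulgA.
  exact: (@word_ballM _ _ 1).
have [t1 tV1] := word_ball1 St.
case: xy => [->|->]; [by exists t|exists t^-1%g => //].
by rewrite quotg_piV mulgK.
Qed.

Lemma word_cayley_path n w x : word_ball S n w ->
  exists s, [/\ path (cayley_adj (p @` S)) x s, last x s = (x * p w)%g
              & (size s <= n)%N].
Proof.
elim: n w => [|n IH] w /=.
  by move=> ->; exists [::]; rewrite /= quotg_pi1 mulg1.
case=> [/IH[s [xs ls ss]]|[u /IH[s [xs ls ss]] [t St <-]]].
  by exists s; rewrite leqW.
exists (rcons s (x * p (u * t))%g); rewrite rcons_path last_rcons size_rcons xs.
split=> //=; apply/asboolP; rewrite ls.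
case: St => [St|[t' St' <-]].
  by exists (p t); [exists t|left; rewrite /p quotg_piM mulgA].
exists (p t'); first by exists t'.
by right; rewrite /p quotg_piM -/p quotg_piV mulgA mulgVK.
Qed.

Lemma cayley_dist_le n w x : word_ball S n w -> dist x (x * p w)%g <= n%:R.
Proof.
move=> /(word_cayley_path x)[s [xs ls ss]].
apply: (@le_trans _ _ (size s)%:R); last by rewrite ler_nat.
apply: ge_inf; first by exists 0 => _ [s' _ <-].
by exists s.
Qed.

Lemma cayley_dist_ge n g x : generates S ->
  (forall w, word_ball S n w -> ~ nsg_set N (w^-1 * g)%g) -> n%:R <= dist x (x * p g)%g.
Proof.
move=> genS nw; rewrite leNgt; apply/negP => /inf_lt[].
  (* Generation connects the two points, so the infimum is over a nonempty set. *)
  have [m mg] := word_ball_exhaust genS g.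
  by have [s [xs ls _]] := word_cayley_path x mg; exists (size s)%:R, s.
move=> _ [s [xs ls] <-]; rewrite ltr_nat => sn.
have [w ws] := cayley_path_word xs; rewrite ls => /mulgI /esym/quotg_piE.
by apply: nw; apply: word_ball_homo ws; exact: ltnW.
Qed.

End CayleyQuotient.

(** * Averages over a finite group *)

Section Averaging.
Variables (R : realFieldType) (Q : groupType) (e : seq Q).
Hypotheses (uniq_e : uniq e) (full_e : forall x, x \in e).

Definition average (F : Q -> R) : R := (size e)%:R^-1 * \sum_(x <- e) F x.

Lemma average_mulr F h : average (fun x => F (x * h)%g) = average F.
Proof.
congr (_ * _); rewrite -(big_map (fun x => x * h)%g predT F).
apply: perm_big; apply: uniq_perm => //.
  by rewrite map_inj_uniq //; exact: mulIg.
by move=> x; rewrite full_e; apply/mapP; exists (x * h^-1)%g; rewrite ?mulgVK.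
Qed.

Lemma le_average F H : (forall x, F x <= H x) -> average F <= average H.
Proof. by move=> FH; rewrite ler_wpM2l ?invr_ge0 ?ler0n// ler_sum. Qed.

Lemma average_cst a : average (fun=> a) = a.
Proof.
rewrite /average big_const_seq count_predT iter_addr_0 -[a *+ _]mulr_natl mulKf//.
by rewrite pnatr_eq0 size_eq0; apply/negP => /eqP e0; have := full_e 1%g; rewrite e0.
Qed.

Lemma average_sum (I : finType) (c : I -> R) (F : I -> Q -> R) :
  average (fun x => \sum_i c i * F i x) = \sum_i c i * average (F i).
Proof.
rewrite /average exchange_big/= mulr_sumr; apply: eq_bigr => i _.
by rewrite -mulr_sumr mulrCA.
Qed.

End Averaging.

(** * Kernels obtained from a single finite quotient *)

Lemma finite_enum (T : choiceType) :
  finite_set [set: T] -> exists e : seq T, uniq e /\ forall x, x \in e.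
Proof.
move=> /finite_seqP[s sE]; exists (undup s); split=> [|x]; first exact: undup_uniq.
by rewrite mem_undup; have : [set: T] x by []; rewrite sE.
Qed.

(** Expanding the squares, the terms in one index only vanish because the [c i] sum to zero; the two
    cross terms each give minus the squared norm of the sum of the [c i *: u i]. *)
Lemma hilbert_cond_neg (R : realType) (H : hilbertType R) n
    (u : 'I_n -> H) (c : 'I_n -> R) : \sum_i c i = 0 ->
  \sum_i \sum_j c i * c j * `|u i - u j| ^+ 2 <= 0.
Proof.
move=> c0; pose d i j := @hdot R H (u i) (u j).
have norm_sub i j : `|u i - u j| ^+ 2 = d i i - d i j - d j i + d j j.
  rewrite -hdot_norm linearBl/= !linearBr/= opprB.
  by rewrite addrA addrAC -addrA addrAC addrA.
have dE : `|\sum_i c i *: u i| ^+ 2 = \sum_i \sum_j c i * c j * d i j.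
  rewrite -hdot_norm linear_sumlz/=; apply: eq_bigr => i _.
  rewrite linear_sumr/=; apply: eq_bigr => j _.
  by rewrite linearZl_LR linearZr_LR/= mulrA.
under eq_bigr do under eq_bigr do rewrite norm_sub mulrDr !mulrBr.
under eq_bigr do rewrite big_split/= !sumrB.
rewrite big_split/= !sumrB [X in _ - X + _]exchange_big/=.
rewrite big1 => [|i _]; last first.
  by under eq_bigr do rewrite mulrAC; rewrite -mulr_sumr c0 mulr0.
rewrite [X in _ + X]exchange_big/= [X in _ + X]big1 => [|j _]; last first.
  by under eq_bigr do rewrite -mulrA; rewrite -mulr_suml c0 mul0r.
rewrite [X in _ - X + _](_ : _ = \sum_i \sum_j c i * c j * d i j); last first.
  by apply: eq_bigr => i _; apply: eq_bigr => j _; rewrite (mulrC (c j)).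
by rewrite -dE addr0 sub0r -opprD oppr_le0 addr_ge0 ?sqr_ge0.
Qed.

(* The last clause bounds psi from below at the elements g whose image in G/N lies
   at word distance at least n from 1. *)
Definition partial_kernel (R : realType) (G : groupType) (S N : set G)
    (rho1 rho2 : R -> R) (m : nat) (psi : G -> R) : Prop :=
  [/\ psi 1%g = 0,
      forall g, psi g^-1%g = psi g,
      forall n (g : 'I_n -> G) (c : 'I_n -> R), \sum_i c i = 0 ->
        (forall i j, word_ball S m ((g i)^-1 * g j)%g) ->
        \sum_i \sum_j c i * c j * psi ((g i)^-1 * g j)%g <= 0,
      forall n g, (n <= m)%N -> word_ball S n g ->
        0 <= psi g <= rho2 n%:R ^+ 2
    & forall n g (a : R), 0 <= a -> (forall x, n%:R <= x -> a <= rho1 x) ->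
        word_ball S m g -> (forall w, word_ball S n w -> ~ N (w^-1 * g)%g) ->
        a ^+ 2 <= psi g].

Section FiniteStage.
Variables (R : realType) (G : groupType) (S : set G) (N : normalSubgroup G).
Hypotheses (genS : generates S) (finN : finite_index N).
Variables (X : metricType R) (iota : quotg N -> X).
Hypothesis iota_isometry : forall x y,
  mdist (iota x) (iota y) = cayley_dist R (@quotg_pi G N @` S) x y.
Variables (Hx : X -> hilbertType R) (s : forall x, Hx x) (rho1 rho2 : R -> R)
  (H : hilbertType R) (m : nat) (K : set X) (t : set X -> forall x, Hx x -> H).
Arguments t : clear implicits.
Hypothesis rho2_homo : {in `[0, +oo[ &, {homo rho2 : x y / x <= y}}.
Let small (C : set X) := C `<=` ~` K /\ (diameter C < m.+1%:R%:E)%E.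
Hypotheses
  (t_control : forall C, small C -> forall x y, C x -> C y ->
    rho1 (mdist x y) <= `|t C x (s x) - t C y (s y)| <= rho2 (mdist x y))
  (t_glue : forall C1 C2, small C1 -> small C2 -> C1 `&` C2 !=set0 ->
    exists2 t12 : H -> H, affine_isometry t12 &
      forall x, (C1 `&` C2) x -> t C1 x = t12 \o t C2 x)
  (iota_K : forall x, ~ K (iota x)).
Let p := @quotg_pi G N.
Let pair x y : set X := [set iota x; iota y].
Let v C (x : quotg N) := t C (iota x) (s (iota x)).

Lemma small_range (I : Type) (x : quotg N) (g : I -> G) :
  (forall i j, word_ball S m ((g i)^-1 * g j)%g) ->
  small (range (fun i => iota (x * p (g i))%g)).
Proof.
move=> gm; split=> [_ [i _ <-]|]; first exact: iota_K.
(* Smallness is a strict bound, hence the scale [m.+1] for diameter at most [m]. *)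
apply: (@le_lt_trans _ _ m%:R%:E); last by rewrite lte_fin ltr_nat.
apply: ge_ereal_sup => _ [_ [i _ <-]] [_ [j _ <-]] <-.
rewrite lee_fin iota_isometry -[g j](mulVKg (g i)) /p quotg_piM mulgA.
exact: cayley_dist_le.
Qed.

Lemma small_pair x g : word_ball S m g -> small (pair x (x * p g)%g).
Proof.
move=> mg; rewrite (_ : pair _ _ =
    range (fun b : bool => iota (x * p (if b then g else 1))%g)).
  have m1 : word_ball S m 1%g by exact: (@word_ball_homo _ _ 0%N m).
  by apply: small_range => -[] [];
    rewrite ?mulVg ?invg1 ?mul1g ?mulg1//; exact: word_ballV.
have p1 : p 1%g = 1%g by [].
apply/seteqP; split=> [_ [->|->]|_ [[] _ <-]].
- by exists false => //; rewrite p1 mulg1.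
- by exists true.
- by right.
- by left; rewrite /= p1 mulg1.
Qed.

(* Gluing makes the distance independent of the patch C in which it is read. *)
Lemma patch_indep C1 C2 x y : small C1 -> small C2 ->
    C1 (iota x) -> C1 (iota y) -> C2 (iota x) -> C2 (iota y) ->
  `|v C1 x - v C1 y| = `|v C2 x - v C2 y|.
Proof.
move=> sC1 sC2 C1x C1y C2x C2y.
have [|f [_ fiso _] fE] := t_glue sC1 sC2; first by exists (iota x).
by rewrite /v !fE//= fiso.
Qed.

Lemma finite_stage :
  exists psi : G -> R, partial_kernel S N rho1 rho2 m psi.
Proof.
have [e [uniq_e full_e]] := finite_enum finN.
(* The distance is read in the smallest patch, the pair itself; [patch_indep] later moves it to
   larger ones. *)
pose k x y := `|v (pair x y) x - v (pair x y) y| ^+ 2.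
have kC x y : k x y = k y x by rewrite /k /pair setUC distrC.
exists (fun g => average e (fun x => k x (x * p g)%g)); split.
- rewrite -[RHS](average_cst full_e); congr average; apply/funext => x.
  by rewrite /k (_ : p 1%g = 1%g)// mulg1 subrr normr0 expr0n.
- move=> g; rewrite -(average_mulr uniq_e full_e _ (p g)); congr average.
  by apply/funext => x; rewrite /p quotg_piV mulgK kC.
- move=> n g c c0 gm.
  (* Translating the average of the [(i, j)] term by [p (g i)] brings all terms to the same base
     point [x]. *)
  have -> : \sum_i \sum_j
      c i * c j * average e (fun x => k x (x * p ((g i)^-1 * g j))%g) =
    average e (fun x =>
      \sum_i \sum_j c i * c j * k (x * p (g i))%g (x * p (g j))%g).
    under [in RHS]eq_fun do rewrite pair_big/=.
    rewrite average_sum pair_big/=; apply: eq_bigr => -[i j] _ /=; congr (_ * _).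
    rewrite -(average_mulr uniq_e full_e _ (p (g i))); congr average.
    by apply/funext => x; rewrite -mulgA -quotg_piM mulVKg.
  rewrite -[leRHS](average_cst full_e); apply: le_average => x /=.
  (* One patch contains all the translates of [x], so the distances come from vectors of the single
     space [H]. *)
  pose C := range (fun i => iota (x * p (g i))%g).
  have sC : small C by exact: small_range.
  have kE i j : k (x * p (g i))%g (x * p (g j))%g =
      `|v C (x * p (g i))%g - v C (x * p (g j))%g| ^+ 2.
    rewrite /k (@patch_indep _ C) //; [|by left|by right|by exists i|by exists j].
    have -> : (x * p (g j) = x * p (g i) * p ((g i)^-1 * g j))%g.
      by rewrite -mulgA -quotg_piM mulVKg.
    exact: small_pair.
  by under eq_bigr do under eq_bigr do rewrite kE; exact: hilbert_cond_neg.
- move=> n g nm ng.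
  have mg : word_ball S m g by exact: word_ball_homo ng.
  have kb x : 0 <= k x (x * p g)%g <= rho2 n%:R ^+ 2.
    rewrite sqr_ge0/=.
    have xg : mdist (iota x) (iota (x * p g)%g) <= n%:R.
      by rewrite iota_isometry; exact: cayley_dist_le.
    have mdist_itv : mdist (iota x) (iota (x * p g)%g) \in `[0, +oo[.
      by rewrite in_itv/= mdist_ge0.
    have nat_itv : (n%:R : R) \in `[0, +oo[ by rewrite in_itv/= ler0n.
    have /andP[_ le2] := t_control (small_pair x mg)
      (or_introl erefl) (or_intror erefl).
    have le3 := le_trans le2 (rho2_homo mdist_itv nat_itv xg).
    (* A control function may be negative; here [rho2] dominates a norm, which allows squaring. *)
    by rewrite lerXn2r ?nnegrE//; exact: le_trans le3.
  rewrite -[X in X <= _ <= _](average_cst full_e).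
  rewrite -[X in _ <= _ <= X](average_cst full_e).
  by rewrite !le_average// => x; case/andP: (kb x).
- move=> n g a a0 rho1a mg nw; rewrite -(average_cst full_e (a ^+ 2)).
  apply: le_average => x /=.
  have /andP[le1 _] := t_control (small_pair x mg)
    (or_introl erefl) (or_intror erefl).
  rewrite lerXn2r ?nnegrE//; apply: le_trans le1; apply: rho1a.
  by rewrite iota_isometry; exact: cayley_dist_ge.
Qed.

End FiniteStage.

(** * Avoiding bounded sets, and limits along filters *)

Lemma bounded_subset_misses (R : realType) (X_ : nat -> Type)
    (dX : forall i, X_ i -> X_ i -> R) (X : metricType R) (iota : {i & X_ i} -> X)
    (K : set X) (m : nat) :
  coarse_disjoint_union dX iota -> (diameter K < +oo)%E ->
  exists2 i, (m <= i)%N & forall x, ~ K (iota (existT _ i x)).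
Proof.
move=> [bij_iota _ far] Kfin.
have [->|/set0P[x0 Kx0]] := eqVneq K set0; first by exists m => // x [].
have dK x : K x -> ((mdist x0 x)%:E <= diameter K)%E.
  by move=> Kx; apply: ereal_sup_ubound; exists x0 => //; exists x.
have [d dE] : exists d, diameter K = d%:E.
  by move: (dK _ Kx0) Kfin; case: (diameter K) => // d; exists d.
case: bij_iota => f _ fK; have [n far_n] := far (d + 1).
case E: (f x0) => [i0 y0]; have {E} x0E : iota (existT _ i0 y0) = x0 by rewrite -E.
(* Beyond [n], component [i] is at distance at least [d + 1] from [x0], more than the diameter of
   [K]; [i0.+1] keeps it distinct from the component of [x0]. *)
pose i := maxn (maxn m n) i0.+1.
exists i => [|x Kx]; first by rewrite !leq_max leqnn.
have i0i : (i0 < i)%N by rewrite leq_max leqnn orbT.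
have ni : (n <= i0 + i)%N.
  by rewrite (leq_trans _ (leq_addl _ _))// !leq_max leqnn orbT.
have ne : i0 <> i by move=> i0E; rewrite {1}i0E ltnn in i0i.
have := far_n _ _ ne ni y0 x; rewrite x0E.
by have := dK _ Kx; rewrite dE lee_fin; lra.
Qed.

Lemma near_forall_finite (T : Type) (I : choiceType) (F : set_system T)
    (A : set I) (P : I -> T -> Prop) : Filter F -> finite_set A ->
  (forall i, A i -> \forall x \near F, P i x) ->
  \forall x \near F, forall i, A i -> P i x.
Proof.
move=> FF finA AP; have := @filter_bigI T I (fset_set A) P F FF.
rewrite fset_setK//= => /(_ _)/filterS; apply=> [x xP i|i].
  exact: xP.
by rewrite in_fset_set// => /set_mem/AP.
Qed.

(** Compactness of the segment gives a cluster point, and an ultrafilter converges to each of its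
    cluster points. *)
Lemma ultra_cvg_bounded (R : realType) (T : Type) (U : set_system T) (f : T -> R)
    (a b : R) : UltraFilter U -> (\forall x \near U, a <= f x <= b) ->
  exists l : R, f x @[x --> U] --> l.
Proof.
move=> ultraU fab.
have fU_proper : ProperFilter (f x @[x --> U]) by apply: fmap_proper_filter.
have [|l [_ lU]] := @segment_compact R a b _ fU_proper.
  by apply: filterS fab => x /=; rewrite in_itv.
exists l => B Bl; have [//|UB] := in_ultra_setVsetC (f @^-1` B) ultraU.
by have [y [nBy]] := lU (~` B) B UB Bl.
Qed.

(** * Passage to the limit and properness *)

Theorem theorem40 (R : realType) (G : groupType) (S : set G)
    (finS : finite_set S) (genS : generates S)
    (resfin : residually_finite G)
    (N : nat -> normalSubgroup G)
    (nested : forall i, N i.+1 `<=` N i)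
    (finidx : forall i, finite_index (N i))
    (trivI : \bigcap_i (N i : set G) = [set 1%g])
    (X : metricType R) (boxX : box_space S N X) :
  fibred_coarse_embedding X -> a_T_menable R G.
Proof.
have N_homo i j : (i <= j)%N -> nsg_set (N j) `<=` nsg_set (N i).
  move=> /subnK <-; elim: (j - i)%N => [//|k IH].
  exact: subset_trans (nested _) IH.
case: boxX => iota cdu [Hx [s [rho1 [rho2 [H [[_ rho1_oo] [rho2_homo _] emb]]]]]].
have stage m : exists psi : G -> R, partial_kernel S (N m) rho1 rho2 m psi.
  have [|K [t [Kfin _ control glue]]] := emb m.+1%:R; first by rewrite ltr0n.
  have [i mi iK] := bounded_subset_misses m cdu Kfin.
  have [_ iso _] := cdu.
  have [psi [psi0 psi1 psi2 psi3 psi4]] :=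
    finite_stage genS (finidx i) (iso i) rho2_homo control glue iK.
  (* The kernel lives on [N i] with [m <= i]; since [N i] lies in [N m], separation modulo [N m]
     implies separation modulo [N i]. *)
  exists psi; split=> // n g a a0 ha mg nw; apply: psi4 ha mg _ => // w nww Nw.
  exact/(nw w nww)/(N_homo _ _ mi).
have [psi_ psi_P] := choice stage.
have [U [ultraU ooU]] := ultraFilterLemma (F := \oo) _.
have eventually_ball g : \forall m \near U, word_ball S m g.
  have [n ng] := word_ball_exhaust genS g.
  by apply: ooU; exists n => // m /= nm; exact: word_ball_homo ng.
have psi_cvg g : exists l : R, psi_ m g @[m --> U] --> l.
  have [n ng] := word_ball_exhaust genS g.
  apply: (@ultra_cvg_bounded _ _ _ _ 0 (rho2 n%:R ^+ 2)).
  apply: ooU; exists n => // m /= nm.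
  by have [_ _ _ bnd _] := psi_P m; exact: bnd.
have [psi psiE] := choice psi_cvg.
exists psi; split.
  split.
  - apply: (cvg_unique (@Rhausdorff R) (psiE 1%g)).
    rewrite (_ : psi_ ^~ 1%g = fun=> 0); first exact: cvg_cst.
    by apply/funext => m; case: (psi_P m).
  - move=> g; apply: (cvg_unique (@Rhausdorff R) (psiE g^-1%g)).
    rewrite (_ : psi_ ^~ g^-1%g = psi_ ^~ g); first exact: psiE.
    by apply/funext => m; case: (psi_P m).
  - move=> n g c c0.
    have sum_cvg :
      \sum_i \sum_j c i * c j * psi_ m ((g i)^-1 * g j)%g @[m --> U] -->
        \sum_i \sum_j c i * c j * psi ((g i)^-1 * g j)%g.
      apply: cvg_big => [|i _]; first exact: add_continuous.
      apply: cvg_big => [|j _]; first exact: add_continuous.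
      by apply: cvgM; [exact: cvg_cst|exact: psiE].
    apply: (cvgr_to_le sum_cvg).
    (* Only finitely many elements occur, so eventually the inequality of stage [m] covers the whole
       family. *)
    have near_g : \forall m \near U, forall ij, [set: 'I_n * 'I_n] ij ->
        word_ball S m ((g ij.1)^-1 * g ij.2)%g.
      by apply: near_forall_finite => [|ij _]; [exact: finite_finset|exact: eventually_ball].
    apply: filterS near_g => m gm.
    by have [_ _ cn _ _] := psi_P m; apply: cn => // i j; exact: (gm (i, j)).
(* This [a] satisfies [M < a ^+ 2], and [rho1] is at least [a] beyond [A]; hence the sublevel set at
   [M] will lie in the ball of radius [L > A]. *)
move=> M; pose a := `|M| + 1.
have [A [_ rho1A]] := cvgry_ge rho1_oo a.
pose L := Num.bound `|A|.
apply: (sub_finite_set _ (word_ball_finite L finS)) => g /= gM.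
apply: contrapT => nLg.
suff : a ^+ 2 <= psi g.
  have := ler_norm (psi g); have := ler_norm M; rewrite /a; nra.
apply: (cvgr_to_ge (psiE g)).
(* As [g] is outside the ball, each [w^-1 * g] is nontrivial and escapes some [N k], then all later
   ones by nesting; finiteness of the ball makes this uniform in [w]. *)
have sep : \forall m \near U, forall w,
    word_ball S L w -> ~ nsg_set (N m) (w^-1 * g)%g.
  apply: near_forall_finite => [|w Lw]; first exact: word_ball_finite.
  have [k Nk] : exists k, ~ nsg_set (N k) (w^-1 * g)%g.
    apply/not_existsP => allN; have : (\bigcap_i (N i : set G)) (w^-1 * g)%g.
      by move=> k _; apply: contrapT; exact: allN.
    rewrite trivI => /= /(congr1 (fun x => w * x)%g).
    by rewrite mulVKg mulg1 => gw; apply: nLg; rewrite gw.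
  by apply: ooU; exists k => // m /= km Nm; apply: Nk; exact: N_homo Nm.
apply: filterS2 sep (eventually_ball g) => m sep_m mg.
have [_ _ _ _ low] := psi_P m.
apply: (low L) => // [|x Lx]; first by rewrite addr_ge0.
apply: rho1A; apply: lt_le_trans Lx; apply: le_lt_trans (ler_norm A) _.
exact: archi_boundP (normr_ge0 A).
Qed.
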